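(* Let $t>0$ and let $\overline F_t(y)=\mathbb P^*[X_t>y]$ be the complementary distribution function of the stock price $X_t$. 1. In the (uncorrelated) Stein-Stein model, $\overline F_t(y)\sim y^{-\alpha_t}\tilde h_t(y)$ as $y\to\infty$, with $\alpha_t=B_3-1$ and $\tilde h_t(y)=\frac1{B_3-1}B_0(\log y)^{-1/2}e^{B_2\sqrt{\log y}}$. 2. In the (uncorrelated) Heston model, $\overline F_t(y)\sim y^{-\alpha_t}\tilde h_t(y)$ as $y\to\infty$, with $\alpha_t=A_3-1$ and $\tilde h_t(y)=\frac1{A_3-1}A_0(\log y)^{-\frac34+\frac{qm}{c^2}}e^{A_2\sqrt{\log y}}$. 3. In the (uncorrelated) Hull-White model, $\overline F_t(y)\sim y^{-1}h_t(y)$ as $y\to\infty$, with $$h_t(y)=C_0(\log y)^{\frac{c_2-1}2}(\log\log y)^{c_3}\exp\left\{-\frac1{2t\xi^2}\left(\log\left[\frac1{y_0}\sqrt{\frac{2\log y}t}\right]+\frac12\log\log\left[\frac1{y_0}\sqrt{\frac{2\log y}t}\right]\right)^2\right\}.$$ Here $B_0,B_2,B_3$, $A_0,A_2,A_3$ and $C_0,c_2,c_3$ are the constants in the asymptotic formulas for the density of $X_t$ given in the context.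
   Context: In all three models $W^*,Z^*$ are independent Brownian motions under $\mathbb P^*$, $X_0=x_0>0$, $Y_0=y_0$, $r\ge0$. Stein-Stein: $dX_t=rX_tdt+|Y_t|X_tdW_t^*$, $dY_t=q(m-Y_t)dt+\sigma dZ_t^*$, with $q,m\ge0$, $\sigma>0$. Heston: $dX_t=rX_tdt+\sqrt{Y_t}X_tdW_t^*$, $dY_t=q(m-Y_t)dt+c\sqrt{Y_t}dZ_t^*$, with $q,m\ge0$, $c>0$. Hull-White: $dX_t=rX_tdt+Y_tX_tdW_t^*$, $dY_t=\nu Y_tdt+\xi Y_tdZ_t^*$, with $\nu\in\mathbb R$, $\xi>0$, $y_0>0$. Let $D_t$ be the density of $X_t$. The following is known (previously established results that may be taken as given), with constants depending on $t$ and the model parameters, as $x\to\infty$. Stein-Stein: there are $B_1>0,B_2>0,B_3>2$ with $D_t(x_0e^{rt}x)=B_1(\log x)^{-1/2}e^{B_2\sqrt{\log x}}x^{-B_3}(1+O((\log x)^{-1/4}))$; put $B_0=B_1(x_0e^{rt})^{B_3}$. Then $D_t(x)=B_0(\log x)^{-1/2}e^{B_2\sqrt{\log x}}x^{-B_3}(1+O((\log x)^{-1/4}))$. Heston: there are $A_1>0,A_2>0,A_3>2$ with $D_t(x_0e^{rt}x)=A_1(\log x)^{-\frac34+\frac{qm}{c^2}}e^{A_2\sqrt{\log x}}x^{-A_3}(1+O((\log x)^{-1/4}))$; put $A_0=A_1(x_0e^{rt})^{A_3}$. Then $D_t(x)=A_0(\log x)^{-\frac34+\frac{qm}{c^2}}e^{A_2\sqrt{\log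 x}}x^{-A_3}(1+O((\log x)^{-1/4}))$. Hull-White: there are constants $C>0$, $c_2,c_3\in\mathbb R$ such that, with $h_t$ as in part 3 of the claim and $C_0=C(x_0e^{rt})^2$, $D_t(x)=x^{-2}h_t(x)(1+O((\log\log x)^{-1/2}))$. $\varphi_1\sim\varphi_2$ means $\varphi_1/\varphi_2\to1$. *)

(* Defs.v *)
From HB Require Import structures.
From mathcomp Require Import all_boot all_order all_algebra.
From mathcomp Require Import all_classical all_reals all_analysis.

Set Implicit Arguments.
Unset Strict Implicit.
Unset Printing Implicit Defensive.

Import Order.TTheory GRing.Theory Num.Theory.
Import numFieldNormedType.Exports.

Local Open Scope classical_set_scope.
Local Open Scope ring_scope.

(* Stochastic processes are families of random variables indexed by all of R;
   only the times s >= 0 are ever constrained or used. *)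

Section stochastic_calculus.
Context (R : realType) (d : measure_display) (Omega : measurableType d).
Variable P : probability Omega R.

Definition filtration (F : R -> set (set Omega)) : Prop :=
  [/\ forall s, 0 <= s -> sigma_algebra setT (F s),
      forall s, 0 <= s -> F s `<=` measurable &
      forall s u, 0 <= s -> s <= u -> F s `<=` F u].

Definition measurable_wrt (G : set (set Omega)) (f : Omega -> R) : Prop :=
  forall B : set R, measurable B -> G (f @^-1` B).

Definition adapted (F : R -> set (set Omega)) (V : R -> {RV P >-> R}) : Prop :=
  forall s, 0 <= s -> measurable_wrt (F s) (V s).

Definition continuous_paths (V : R -> {RV P >-> R}) : Prop :=
  forall w, {within `[0, +oo[, continuous (fun s => V s w)}.

Definition independent (G H : set (set Omega)) : Prop :=
  forall A B, G A -> H B -> P (A `&` B) = (P A * P B)%E.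

Definition sigma_rv (f : Omega -> R) : set (set Omega) :=
  preimage_set_system setT f measurable.

Definition sigma_process (V : R -> {RV P >-> R}) : set (set Omega) :=
  <<s \bigcup_(s in `[0, +oo[) sigma_rv (V s) >>.

(* Standard Brownian motion with respect to the filtration F; the second
   parameter of normal_prob is the standard deviation. *)
Definition brownian_motion (F : R -> set (set Omega))
    (W : R -> {RV P >-> R}) : Prop :=
  [/\ adapted F W,
      continuous_paths W,
      {ae P, forall w, W 0 w = 0} &
      forall s u, 0 <= s -> s < u ->
        independent (F s) (sigma_rv (fun w => W u w - W s w)) /\
        forall B : set R, measurable B ->
          P ((fun w => W u w - W s w) @^-1` B) =
          normal_prob 0 (Num.sqrt (u - s)) B].

(* The process \sum_(i < size) val_i * \1_(]time_i, time_(i+1)]). *)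
Record simple_process (F : R -> set (set Omega)) := SimpleProcess {
  sp_size : nat ;
  sp_time : nat -> R ;
  sp_val : nat -> Omega -> R ;
  sp_time_ge0 : forall i, 0 <= sp_time i ;
  sp_time_le : forall i, sp_time i <= sp_time i.+1 ;
  sp_val_meas : forall i, measurable_wrt (F (sp_time i)) (sp_val i) ;
  sp_val_bounded : forall i, exists M, forall w, `|sp_val i w| <= M
}.

Definition simple_process_eval F (phi : simple_process F) (s : R) (w : Omega) : R :=
  \sum_(i < sp_size phi)
    sp_val phi i w * \1_(`]sp_time phi i, sp_time phi i.+1]) s.

(* \int_0^t phi dW *)
Definition simple_integral F (W : R -> {RV P >-> R}) (phi : simple_process F)
    (t : R) (w : Omega) : R :=
  \sum_(i < sp_size phi)
    sp_val phi i w *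
    (W (Num.min (sp_time phi i.+1) t) w - W (Num.min (sp_time phi i) t) w).

(* I is (a version of) the Ito integral \int_0^t H dW: some simple processes
   phi_n satisfy \int_0^t (phi_n - H)^2 ds --> 0 and \int_0^t phi_n dW --> I,
   both in probability. *)
Definition ito_integral (F : R -> set (set Omega)) (W : R -> {RV P >-> R})
    (H : R -> Omega -> R) (t : R) (I : {RV P >-> R}) : Prop :=
  exists phi : nat -> simple_process F,
    (forall eps : R, 0 < eps ->
       P [set w | (eps%:E <= \int[lebesgue_measure]_(s in `[0%R, t])
                    ((simple_process_eval (phi n) s w - H s w) ^+ 2)%R%:E)%E]
       @[n --> \oo] --> 0%E) /\
    (forall eps : R, 0 < eps ->
       P [set w | eps <= `|simple_integral W (phi n) t w - I w|]
       @[n --> \oo] --> 0%E).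

(* dV_s = a_s ds + b_s dW_s with V_0 = v0. *)
Definition sde_solution (F : R -> set (set Omega)) (W V : R -> {RV P >-> R})
    (v0 : R) (a b : R -> Omega -> R) : Prop :=
  [/\ adapted F V,
      continuous_paths V,
      {ae P, forall w, V 0 w = v0} &
      forall t, 0 <= t -> exists I : {RV P >-> R},
        ito_integral F W b t I /\
        {ae P, forall w,
          V t w = V 0 w + \int[lebesgue_measure]_(s in `[0, t]) a s w + I w}].

Definition independent_brownian_motions (F : R -> set (set Omega))
    (W Z : R -> {RV P >-> R}) : Prop :=
  [/\ filtration F, brownian_motion F W, brownian_motion F Z &
      independent (sigma_process W) (sigma_process Z)].

Definition stein_stein_model (F : R -> set (set Omega))
    (W Z X Y : R -> {RV P >-> R}) (x0 y0 r q m sigma : R) : Prop :=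
  [/\ independent_brownian_motions F W Z,
      [/\ 0 < x0, 0 <= r, 0 <= q, 0 <= m & 0 < sigma],
      sde_solution F W X x0
        (fun s w => r * X s w) (fun s w => `|Y s w| * X s w) &
      sde_solution F Z Y y0
        (fun s w => q * (m - Y s w)) (fun=> fun=> sigma)].

(* Num.sqrt vanishes on negative numbers; for y0 >= 0 the process Y stays
   nonnegative almost surely, so this convention is harmless. *)
Definition heston_model (F : R -> set (set Omega))
    (W Z X Y : R -> {RV P >-> R}) (x0 y0 r q m c : R) : Prop :=
  [/\ independent_brownian_motions F W Z,
      [/\ 0 < x0, 0 <= r, 0 <= q, 0 <= m & 0 < c],
      sde_solution F W X x0
        (fun s w => r * X s w) (fun s w => Num.sqrt (Y s w) * X s w) &
      sde_solution F Z Y y0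
        (fun s w => q * (m - Y s w)) (fun s w => c * Num.sqrt (Y s w))].

Definition hull_white_model (F : R -> set (set Omega))
    (W Z X Y : R -> {RV P >-> R}) (x0 y0 r nu xi : R) : Prop :=
  [/\ independent_brownian_motions F W Z,
      [/\ 0 < x0, 0 < y0, 0 <= r & 0 < xi],
      sde_solution F W X x0
        (fun s w => r * X s w) (fun s w => Y s w * X s w) &
      sde_solution F Z Y y0
        (fun s w => nu * Y s w) (fun s w => xi * Y s w)].

Definition is_density (V : {RV P >-> R}) (D : R -> R) : Prop :=
  [/\ measurable_fun setT D, forall x, 0 <= D x &
      forall B : set R, measurable B ->
        distribution P V B = (\int[lebesgue_measure]_(x in B) (D x)%:E)%E].

End stochastic_calculus.

Section asymptotics.
Context (R : realType).

(* The O_F notations need the filter bundled with its proof. *)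
Definition pinfty_filter : filter_on R := FilterType (+oo_ R) _.

(* f x = g x * (1 + O(e x)) as x --> +oo *)
Definition asymptotic_with_error (f g e : R -> R) : Prop :=
  exists delta : R -> R,
    (delta : R -> R^o) =O_pinfty_filter (e : R -> R^o) /\
    \forall x \near +oo, f x = g x * (1 + delta x).

Definition asymptotic_equiv (f g : R -> R) : Prop :=
  f y / g y @[y --> +oo] --> (1 : R).

(* b0 (log x)^p e^{b2 sqrt(log x)} *)
Definition log_exp_factor (b0 p b2 x : R) : R :=
  b0 * ln x `^ p * expR (b2 * Num.sqrt (ln x)).

Definition hull_white_factor (t y0 xi C0 c2 c3 x : R) : R :=
  let L := ln (y0^-1 * Num.sqrt (2 * ln x / t)) in
  C0 * ln x `^ ((c2 - 1) / 2) * ln (ln x) `^ c3 *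
  expR (- (2 * t * xi ^+ 2)^-1 * (L + 2^-1 * ln L) ^+ 2).

End asymptotics.

(* Main.v *)
(* A positive function x^(-a-1) L(x) with L(x) = exp (l (ln x)) and l' -> 0 at
   infinity satisfies x L'(x) / L(x) = l'(ln x) -> 0, so the derivative of
   G(y) = a^-1 y^(-a) L(y) is equivalent to - x^(-a-1) L(x), and G vanishes at
   infinity. A density D equivalent to x^(-a-1) L(x) is therefore equivalent to
   - G', and integrating over ]y, +oo[ shows that its tail is equivalent to G.
   In the first two models l(s) = ln b0 + p ln s + b2 sqrt s; in the Hull-White
   model a = 1 and l(s) contains the square of u(s) = L + (ln L)/2 with
   L = (ln s)/2 + k, whose slope 2 u u' = O(ln s / s) also vanishes. *)
Require Import Defs.
From HB Require Import structures.
From mathcomp Require Import all_boot all_order all_algebra.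
From mathcomp Require Import all_classical all_reals all_analysis.
From mathcomp Require Import measurable_realfun ring lra.

Import Order.TTheory GRing.Theory Num.Theory.
Import numFieldNormedType.Exports.

Local Open Scope classical_set_scope.
Local Open Scope ring_scope.

(** * Limits at infinity and integrals over half-lines *)

Lemma cvg_ln_pinfty {R : realType} : ln x @[x --> +oo] --> (+oo : set_system R).
Proof.
apply/cvgryPge => A; near=> x.
have x0 : 0 < x by near: x; exact: nbhs_pinfty_gt.
by rewrite -[leLHS]expRK ler_ln ?posrE ?expR_gt0.
Unshelve. all: by end_near. Qed.

(** A property used under an integral over []y, +oo[] must hold on the whole half-line, so one large
    [y] has to serve all [x >= y]. *)
Lemma near_pinfty_upset {R : realType} [A : set R] :
  (\forall x \near +oo, A x) -> \forall y \near +oo, forall x, y <= x -> A x.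
Proof.
move=> [M [Mr MA]]; exists M; split => // y My x yx; exact/MA/(lt_le_trans My).
Qed.

(* L'Hopital's rule for tail integrals *)
Lemma tail_integral_equiv {R : realType} (f g G : R -> R) :
  measurable_fun setT f -> (forall x, 0 <= f x) ->
  (\forall x \near +oo, is_derive x (1 : R) G (- g x)) ->
  (\forall x \near +oo, {for x, continuous g}) ->
  (\forall x \near +oo, 0 < g x) ->
  (\forall x \near +oo, 0 < G x) ->
  G x @[x --> +oo] --> (0 : R) ->
  f x / g x @[x --> +oo] --> (1 : R) ->
  fine (\int[lebesgue_measure]_(x in `]y, +oo[) (f x)%:E) / G y
    @[y --> +oo] --> (1 : R).
Proof.
move=> mf f0 dG cg g0 G0 Gcvg /cvgrPdist_le fg.
apply/cvgrPdist_le => e e0.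
have {fg} := near_pinfty_upset (fg e e0).
move: dG cg g0 => /near_pinfty_upset dG' /near_pinfty_upset cg'.
move=> /near_pinfty_upset g0' fg'.
near=> y.
have dG : forall x, y <= x -> is_derive x 1 G (- g x) by near: y.
have cg : forall x, y <= x -> {for x, continuous g} by near: y.
have g0 : forall x, y <= x -> 0 < g x by near: y.
have fg : forall x, y <= x -> `|1 - f x / g x| <= e by near: y.
have Gy0 : 0 < G y by near: y.
have mg : measurable_fun `]y, +oo[ g.
  apply: open_continuous_measurable_fun => //.
  by move=> x; rewrite inE/= in_itv/= andbT => /ltW; exact: cg.
have cGy : {for y, continuous G}.
  by apply/differentiable_continuous/derivable1_diffP; have [] := dG y (lexx y).
(* [- G] is an antiderivative of [g] with limit 0 at infinity, so the fundamental theorem of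
   calculus gives [0 - (- G y)]. It is stated for the closed half-line, hence the change of
   endpoint. *)
have intg : (\int[lebesgue_measure]_(x in `]y, +oo[) (g x)%:E = (G y)%:E)%E.
  rewrite integral_itv_obnd_cbnd; last exact/measurable_EFinP.
  rewrite (@ge0_continuous_FTC2y _ g (- G) y 0).
  - by rewrite sub0e -EFinN /= opprK.
  - by move=> x /g0/ltW.
  - apply/continuous_within_itvcyP; split.
      by move=> x; rewrite in_itv/= andbT => /ltW; exact: cg.
    by apply: cvg_at_right_filter; exact: cg.
  - by rewrite -oppr0; exact: cvgN.
  - by move=> x /ltW /dG [dGx _]; exact: derivableN.
  - by apply: cvgN; exact: cvg_at_right_filter.
  - move=> x; rewrite in_itv/= andbT => /ltW /dG dGx.
    by rewrite derive1E deriveN// (@derive_val _ _ _ _ _ _ _ dGx) opprK.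
have mf' : measurable_fun `]y, +oo[ f by exact: measurable_funS mf.
(* Clearing the denominator [g x > 0] gives a pointwise sandwich, which is then integrated on both
   sides. *)
have fle x : y <= x -> (1 - e) * g x <= f x <= (1 + e) * g x.
  move=> yx; have := fg _ yx; rewrite ler_distlC => /andP[].
  by rewrite ler_pdivlMr ?ler_pdivrMr ?g0// => -> ->.
have leI :
    (\int[lebesgue_measure]_(x in `]y, +oo[) (f x)%:E <= ((1 + e) * G y)%:E)%E.
  rewrite EFinM -intg -ge0_integralZl//.
  - apply: ge0_le_integral => //.
    + by move=> x _; rewrite lee_fin.
    + exact/measurable_EFinP.
    + by apply/measurable_EFinP; exact: measurable_funM.
    + by move=> x /=; rewrite in_itv/= andbT => /ltW/fle/andP[].
  - exact/measurable_EFinP.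
  - by move=> x /=; rewrite in_itv/= andbT => /ltW/g0/ltW gx; rewrite lee_fin.
  - by rewrite lee_fin addr_ge0// ltW.
have I0 : (0 <= \int[lebesgue_measure]_(x in `]y, +oo[) (f x)%:E)%E.
  by apply: integral_ge0 => x _; rewrite lee_fin.
have geI :
    (((1 - e) * G y)%:E <= \int[lebesgue_measure]_(x in `]y, +oo[) (f x)%:E)%E.
  (* The factor [1 - e] leaves the integral only when it is nonnegative; for [e > 1] the lower bound
     is nonpositive and holds trivially. *)
  have [e1|e1] := leP e 1; last first.
    apply: le_trans I0; rewrite lee_fin mulr_le0_ge0 ?(ltW Gy0)//.
    by rewrite subr_le0 ltW.
  rewrite EFinM -intg -ge0_integralZl//.
  - apply: ge0_le_integral => //.
    + move=> x /=; rewrite in_itv/= andbT => /ltW/g0/ltW gx.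
      by rewrite -EFinM lee_fin mulr_ge0// subr_ge0.
    + by apply/measurable_EFinP; exact: measurable_funM.
    + exact/measurable_EFinP.
    + by move=> x /=; rewrite in_itv/= andbT => /ltW/fle/andP[].
  - exact/measurable_EFinP.
  - by move=> x /=; rewrite in_itv/= andbT => /ltW/g0/ltW gx; rewrite lee_fin.
  - by rewrite lee_fin subr_ge0.
(* [fine] sends an infinite value to 0, so finiteness must be settled first; the upper bound
   provides it. *)
have If : (\int[lebesgue_measure]_(x in `]y, +oo[) (f x)%:E)%E \is a fin_num.
  by rewrite ge0_fin_numE// (le_lt_trans leI)// ltry.
rewrite ler_distlC ler_pdivlMr// ler_pdivrMr//.
by rewrite -!lee_fin fineK// leI geI.
Unshelve. all: by end_near. Qed.

(** * Functions whose derivative vanishes at infinity *)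

(** The derivative is an explicit witness, so closed forms can be supplied. Its continuity makes the
    integrand of the fundamental theorem continuous. Everything is asked only near infinity, since
    functions such as [ln (ln s)] are smooth only there. *)
Definition vanishing_slope {R : realType} (l : R -> R) : Prop :=
  exists dl : R -> R,
    [/\ \forall s \near +oo, is_derive s (1 : R) l (dl s),
        \forall s \near +oo, {for s, continuous dl} &
        dl s @[s --> +oo] --> (0 : R)].

(** Mean value theorem on [[s, u]], with [s] so large that the derivative is at most [e] in absolute
    value beyond it. *)
Lemma vanishing_slope_increment {R : realType} [l : R -> R] [e : R] :
  vanishing_slope l -> 0 < e ->
  \forall s \near +oo, forall u, s <= u -> `|l u - l s| <= e * (u - s).
Proof.
move=> [dl [/near_pinfty_upset dl' _ /cvgr0Pnorm_le dl0]] e0.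
have /near_pinfty_upset dle := dl0 e e0.
near=> s => u su.
have dls : forall x, s <= x -> is_derive x (1 : R) l (dl x) by near: s.
have dlse : forall x, s <= x -> `|dl x| <= e by near: s.
have [x| |c] := @MVT_segment R l dl s u su.
- by rewrite in_itv/= => /andP[/ltW sx _]; exact: dls.
- apply: derivable_within_continuous => x; rewrite in_itv/= => /andP[sx _].
  by have [] := dls x sx.
rewrite in_itv/= => /andP[sc _] ->.
by rewrite normrM (@ger0_norm _ (u - s)) ?subr_ge0// ler_wpM2r ?subr_ge0// dlse.
Unshelve. all: by end_near. Qed.

(** A step of fixed length [|k|] changes [l] by at most a small slope times [|k|]. Rescaling [x] by
    a constant is such a translation of [ln x]. *)
Lemma vanishing_slope_shift {R : realType} [l : R -> R] (k : R) :
  vanishing_slope l -> l (s - k) - l s @[s --> +oo] --> (0 : R).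
Proof.
move=> lv; apply/cvgr0Pnorm_le => e e0.
have k1 : 0 < `|k| + 1 by rewrite ltr_pwDr.
(* The summand 1 keeps the denominator positive when [k = 0]. *)
have e'0 : 0 < e / (`|k| + 1) by rewrite divr_gt0.
have [M [Mr MA]] := vanishing_slope_increment lv e'0.
have bnd : e / (`|k| + 1) * `|k| <= e.
  by rewrite mulrAC ler_pdivrMr// ler_pM2l// lerDl.
near=> s.
have Ms : M < s by near: s; exact: (nbhs_pinfty_gt (num_real _)).
have Mks : M + k < s by near: s; exact: (nbhs_pinfty_gt (num_real _)).
apply: le_trans bnd.
(* The increment bound runs forward from its base point, which is the smaller of [s - k] and [s];
   both lie beyond [M]. *)
have [k0|/ltW k0] := leP 0 k.
- rewrite distrC (_ : e / _ * _ = e / (`|k| + 1) * (s - (s - k))).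
    by apply: MA; rewrite ?ltrBrDr// lerBlDr lerDl.
  by rewrite (ger0_norm k0); congr (_ * _); ring.
- rewrite (_ : e / _ * _ = e / (`|k| + 1) * (s - k - s)).
    by apply: MA => //; rewrite lerBrDr gerDl.
  by rewrite (ler0_norm k0); congr (_ * _); ring.
Unshelve. all: by end_near. Qed.

(** Eventually [l] grows with slope at most [a / 2], so [l s - a * s] is at most a constant minus
    [a / 2 * s]. *)
Lemma vanishing_slope_expR_cvg0 {R : realType} [l : R -> R] [a : R] :
  vanishing_slope l -> 0 < a ->
  expR (l s - a * s) @[s --> +oo] --> (0 : R).
Proof.
move=> lv a0; have a20 : 0 < a / 2 by rewrite divr_gt0.
have [M [Mr MA]] := vanishing_slope_increment lv a20.
(* The increment bound holds strictly beyond [M], so [M + 1] is the base point; [c] is the intercept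
   of the resulting linear bound. *)
set c := l (M + 1) - a / 2 * (M + 1).
have lec s : M + 1 <= s -> l s - a * s <= c - a / 2 * s.
  move=> Ms; have := MA (M + 1) _ s Ms; rewrite ltrDl ltr01 => /(_ isT).
  by rewrite ler_norml /c => /andP[_]; lra.
apply/cvgr0Pnorm_le => e e0; near=> s.
rewrite ger0_norm ?expR_ge0// -[leRHS]lnK// ler_expR.
have /le_trans : l s - a * s <= c - a / 2 * s.
  by apply: lec; near: s; exact: (nbhs_pinfty_ge (num_real _)).
apply; rewrite lerBlDr -lerBlDl -ler_pdivrMl//.
Unshelve. all: by end_near. Qed.

(** The tail integral rule is applied with [G] the claimed equivalent and [g] equal to [- G'], which
    differs from the model density by a factor tending to 1. *)
Lemma density_tail_equiv {R : realType} [D l : R -> R] [a : R] :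
  0 < a -> vanishing_slope l ->
  measurable_fun setT D -> (forall x, 0 <= D x) ->
  D x / expR (l (ln x) - (a + 1) * ln x) @[x --> +oo] --> (1 : R) ->
  fine (\int[lebesgue_measure]_(x in `]y, +oo[) (D x)%:E) /
    (a^-1 * expR (l (ln y) - a * ln y)) @[y --> +oo] --> (1 : R).
Proof.
move=> a0 lv mD D0 DE; have [dl [dlE cdl dl0]] := lv.
(* This is [- G']: the chain rule gives the factor [(dl (ln x) - a) / x], and [1 / x] turns [a] into
   [a + 1] in the exponent. *)
pose g x := expR (l (ln x) - (a + 1) * ln x) * (1 - a^-1 * dl (ln x)).
have lny := @cvg_ln_pinfty R.
have dlln0 : dl (ln x) @[x --> +oo] --> (0 : R) by exact: cvg_comp lny dl0.
have fac1 : 1 - a^-1 * dl (ln x) @[x --> +oo] --> (1 : R).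
  rewrite -[X in _ --> X]subr0; apply: cvgB; first exact: cvg_cst.
  by rewrite -(mulr0 a^-1); apply: cvgM => //; exact: cvg_cst.
have fac0 : \forall x \near +oo, 0 < 1 - a^-1 * dl (ln x).
  exact: (cvgr_gt _ fac1).
have dlln : \forall x \near +oo, is_derive (ln x) (1 : R) l (dl (ln x)).
  exact: (lny _ dlE).
have cdlln : \forall x \near +oo, {for (ln x), continuous dl}.
  exact: (lny _ cdl).
have G0 : a^-1 * expR (l (ln x) - a * ln x) @[x --> +oo] --> (0 : R).
  rewrite -(mulr0 a^-1); apply: cvgM; first exact: cvg_cst.
  exact: cvg_comp lny (vanishing_slope_expR_cvg0 lv a0).
apply: (@tail_integral_equiv _ D g) => //.
- near=> x; have x0 : 0 < x by near: x; exact: (nbhs_pinfty_gt (num_real _)).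
  have dx : is_derive (ln x) (1 : R) l (dl (ln x)) by near: x.
  have dlnx := is_derive1_ln x0.
  pose h := (fun s => l s - a * s) : R -> R.
  have dh : is_derive (ln x) (1 : R) h (dl (ln x) - a).
    by apply: trigger_derive; rewrite scaler1.
  have dhl := @is_derive1_comp _ h (@ln R) x _ _ dh dlnx.
  have de :=
    @is_derive1_comp _ (@expR R) (h \o @ln R) x _ _ (is_derive_expR _) dhl.
  apply: trigger_derive; rewrite /g /h/=.
  have -> : l (ln x) - (a + 1) * ln x = l (ln x) - a * ln x - ln x by ring.
  rewrite [in RHS]expRB lnK ?posrE// /GRing.scale/=.
  by field; rewrite (gt_eqF a0) (gt_eqF x0).
- near=> x; have x0 : 0 < x by near: x; exact: (nbhs_pinfty_gt (num_real _)).
  have dx : is_derive (ln x) (1 : R) l (dl (ln x)) by near: x.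
  have cx : {for (ln x), continuous dl} by near: x.
  have cl : {for (ln x), continuous l}.
    by apply/differentiable_continuous/derivable1_diffP; have [] := dx.
  have cln := continuous_ln x0.
  apply: cvgM.
    apply: continuous_comp; last exact: continuous_expR.
    apply: cvgB; first exact: continuous_comp cln cl.
    by apply: cvgM => //; exact: cvg_cst.
  apply: cvgB; first exact: cvg_cst.
  by apply: cvgM; [exact: cvg_cst|exact: continuous_comp cln cx].
- near=> x; rewrite /g mulr_gt0 ?expR_gt0//; near: x; exact: fac0.
- by near=> x; rewrite mulr_gt0 ?expR_gt0// invr_gt0.
(* The correction factor is split off, leaving the assumed quotient times a quantity tending to
   1. *)
- have -> : (fun x => D x / g x) =
      (fun x => D x / expR (l (ln x) - (a + 1) * ln x)) \*
      (fun x => (1 - a^-1 * dl (ln x))^-1).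
    by apply/funext => x; rewrite /g/= invfM mulrA.
  rewrite -[X in _ --> X]mulr1; apply: cvgM => //.
  by rewrite -[X in _ --> X]invr1; apply: cvgV => //; exact: oner_neq0.
Unshelve. all: by end_near. Qed.

(** * Elementary limits, and stability and examples of vanishing slope *)

Lemma cvg_sqrt_pinfty {R : realType} :
  Num.sqrt x @[x --> +oo] --> (+oo : set_system R).
Proof.
apply/cvgryPge => A; near=> x.
apply: le_trans (ler_norm A) _; rewrite -sqrtr_sqr ler_sqrt.
  by near: x; exact: (nbhs_pinfty_ge (num_real _)).
by near: x; exact: (nbhs_pinfty_ge (num_real _)).
Unshelve. all: by end_near. Qed.

Lemma cvgV_pinfty {R : realType} [f : R -> R] :
  f x @[x --> +oo] --> (+oo : set_system R) ->
  (f x)^-1 @[x --> +oo] --> (0 : R).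
Proof.
move=> fy; have [_] := @gtr0_cvgV0 R R +oo _ f (cvgry_gt fy 0); exact.
Qed.

(** Since [ln x = 2 * ln (sqrt x) <= 2 * sqrt x], the quotient is at most [2 / sqrt x]. *)
Lemma cvg_ln_div_id {R : realType} : ln x / x @[x --> +oo] --> (0 : R).
Proof.
have sqrtV := cvgV_pinfty (@cvg_sqrt_pinfty R).
apply: (@squeeze_cvgr _ _ _ _ (fun=> 0) (fun x => 2 * (Num.sqrt x)^-1)).
- near=> x.
  have x1 : 1 <= x by near: x; exact: (nbhs_pinfty_ge (num_real _)).
  have x0 : 0 < x by exact: lt_le_trans x1.
  have sx0 : 0 < Num.sqrt x by rewrite sqrtr_gt0.
  have lnE : ln x = 2 * ln (Num.sqrt x).
    by rewrite -[in LHS](sqr_sqrtr (ltW x0)) lnXn// mulr_natl.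
  rewrite divr_ge0 ?ln_ge0 ?(ltW x0)//= lnE -mulrA ler_pM2l//.
  have sE : (Num.sqrt x)^-1 * x = Num.sqrt x.
    by rewrite -[X in _ * X](sqr_sqrtr (ltW x0)) expr2 mulKf ?gt_eqF.
  rewrite ler_pdivrMr// sE.
  exact/ltW/ln_sublinear.
- exact: cvg_cst.
- by rewrite -(mulr0 2); apply: cvgM => //; exact: cvg_cst.
Unshelve. all: by end_near. Qed.

Lemma vanishing_slope_cst {R : realType} (c : R) : vanishing_slope (cst c).
Proof.
exists (cst 0); split.
- by apply: nearW => s; exact: is_derive_cst.
- by apply: nearW => s; exact: cvg_cst.
- exact: cvg_cst.
Qed.

Lemma vanishing_slopeD {R : realType} [l m : R -> R] :
  vanishing_slope l -> vanishing_slope m ->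
  vanishing_slope (fun s => l s + m s).
Proof.
move=> [dl [lE cl l0]] [dm [mE cm m0]]; exists (fun s => dl s + dm s); split.
- near=> s; apply: is_deriveD; near: s; [exact: lE|exact: mE].
- near=> s; apply: cvgD; near: s; [exact: cl|exact: cm].
- by rewrite -[X in _ --> X]addr0; exact: cvgD.
Unshelve. all: by end_near. Qed.

Lemma vanishing_slopeZ {R : realType} (c : R) [l : R -> R] :
  vanishing_slope l -> vanishing_slope (fun s => c * l s).
Proof.
move=> [dl [lE cl l0]]; exists (fun s => c * dl s); split.
- near=> s; apply: is_deriveZ; near: s; exact: lE.
- near=> s; apply: cvgM; first exact: cvg_cst.
  near: s; exact: cl.
- by rewrite -(mulr0 c); apply: cvgM => //; exact: cvg_cst.
Unshelve. all: by end_near. Qed.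

Lemma vanishing_slope_ln {R : realType} : vanishing_slope (@ln R).
Proof.
exists (fun s => s^-1); split.
- near=> s; apply: is_derive1_ln; near: s; exact: (nbhs_pinfty_gt (num_real _)).
- near=> s; have s0 : 0 < s by near: s; exact: (nbhs_pinfty_gt (num_real _)).
  by apply: inv_continuous; rewrite gt_eqF.
- exact/cvgV_pinfty/cvg_id.
Unshelve. all: by end_near. Qed.

Lemma vanishing_slope_sqrt {R : realType} : vanishing_slope (@Num.sqrt R).
Proof.
exists (fun s => (2 * Num.sqrt s)^-1); split.
- near=> s; apply: is_derive1_sqrt; near: s.
  exact: (nbhs_pinfty_gt (num_real _)).
- near=> s; have s0 : 0 < s by near: s; exact: (nbhs_pinfty_gt (num_real _)).
  apply: cvgV; first by rewrite mulf_neq0 ?gt_eqF ?sqrtr_gt0.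
  by apply: cvgM; [exact: cvg_cst|exact: sqrt_continuous].
- apply: cvgV_pinfty; under eq_fun do rewrite mulrC.
  by apply: gt0_cvgMly => //; exact: cvg_sqrt_pinfty.
Unshelve. all: by end_near. Qed.

Lemma vanishing_slope_ln_ln {R : realType} :
  vanishing_slope (fun s : R => ln (ln s)).
Proof.
exists (fun s => (ln s)^-1 * s^-1); split.
- near=> s; have s1 : 1 < s by near: s; exact: (nbhs_pinfty_gt (num_real _)).
  have s0 : 0 < s by exact: lt_trans s1.
  exact: (is_derive1_comp (is_derive1_ln (ln_gt0 s1)) (is_derive1_ln s0)).
- near=> s; have s1 : 1 < s by near: s; exact: (nbhs_pinfty_gt (num_real _)).
  have s0 : 0 < s by exact: lt_trans s1.
  apply: cvgM; last by apply: inv_continuous; rewrite gt_eqF.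
  by apply: cvgV; [rewrite gt_eqF ?ln_gt0|exact: continuous_ln].
- rewrite -(mulr0 0); apply: cvgM; last exact/cvgV_pinfty/cvg_id.
  exact/cvgV_pinfty/cvg_ln_pinfty.
Unshelve. all: by end_near. Qed.

(** This is the square in the Hull-White exponent, with [s] standing for [ln x]. Its slope is at
    most [4 * L s / s], of order [ln s / s]. *)
Lemma vanishing_slope_ln_sqr {R : realType} (k : R) :
  vanishing_slope
    (fun s => (2^-1 * ln s + k + 2^-1 * ln (2^-1 * ln s + k)) ^+ 2).
Proof.
pose L s : R := 2^-1 * ln s + k.
pose u s : R := L s + 2^-1 * ln (L s).
have Ly : L s @[s --> +oo] --> (+oo : set_system R).
  apply/cvgryPge => A; near=> s; rewrite /L -lerBlDr -ler_pdivrMl//.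
  near: s; exact: (cvgry_ge (@cvg_ln_pinfty R) _).
(* The threshold 1 makes [ln (L s)] nonnegative and [(L s)^-1] at most 1, as the final estimate
   requires. *)
have L1 := cvgry_ge Ly 1.
(* This is [2 * u * u'], where [L' = 2^-1 * s^-1] is factored out of [u']. *)
pose dl s : R := 2 * u s * ((1 + 2^-1 * (L s)^-1) * (2^-1 * s^-1)).
exists dl; split.
- near=> s.
  have s0 : 0 < s by near: s; exact: (nbhs_pinfty_gt (num_real _)).
  have Ls1 : 1 <= L s by near: s; exact: L1.
  have Ls0 : 0 < L s by exact: lt_le_trans Ls1.
  have dL : is_derive s (1 : R) L (2^-1 * s^-1).
    have ds := is_derive1_ln s0.
    by apply: trigger_derive; rewrite addr0.
  have dlnL := is_derive1_comp (is_derive1_ln Ls0) dL.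
  have du : is_derive s (1 : R) u
      (2^-1 * s^-1 + 2^-1 * ((L s)^-1 * (2^-1 * s^-1))).
    exact: (is_deriveD dL (is_deriveZ 2^-1 dlnL)).
  apply: (is_derive_eq (is_deriveX 2 du)).
  by rewrite /dl expr1 /GRing.scale/=; ring.
- near=> s.
  have s0 : 0 < s by near: s; exact: (nbhs_pinfty_gt (num_real _)).
  have Ls1 : 1 <= L s by near: s; exact: L1.
  have Ls0 : 0 < L s by exact: lt_le_trans Ls1.
  have cL : {for s, continuous L}.
    apply: cvgD; last exact: cvg_cst.
    by apply: cvgM; [exact: cvg_cst|exact: continuous_ln].
  have clnL : {for s, continuous (fun s => ln (L s))}.
    exact: continuous_comp cL (continuous_ln Ls0).
  have cu : {for s, continuous u}.
    by apply: cvgD => //; apply: cvgM => //; exact: cvg_cst.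
  apply: cvgM; first by apply: cvgM => //; exact: cvg_cst.
  apply: cvgM.
    apply: cvgD; first exact: cvg_cst.
    apply: cvgM; first exact: cvg_cst.
    by apply: cvgV; rewrite ?gt_eqF.
  by apply: cvgM; [exact: cvg_cst|apply: inv_continuous; rewrite gt_eqF].
(* From [ln L <= L] comes [u <= 2 * L], and [1 + 2^-1 * L^-1 <= 2]; the product of these bounds
   gives the constant 4. *)
- apply: (@squeeze_cvgr _ _ _ _ (fun=> 0) (fun s => 4 * (L s / s))).
  + near=> s.
    have s0 : 0 < s by near: s; exact: (nbhs_pinfty_gt (num_real _)).
    have Ls1 : 1 <= L s by near: s; exact: L1.
    have Ls0 : 0 < L s by exact: lt_le_trans Ls1.
    have lnL0 := ln_ge0 Ls1.
    have lnLL := ltW (ln_sublinear Ls0).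
    have u0 : 0 <= u s by rewrite /u; lra.
    have uL : u s <= 2 * L s by rewrite /u; lra.
    have LV0 : 0 <= (L s)^-1 by rewrite invr_ge0 ltW.
    have LV1 : (L s)^-1 <= 1 by rewrite invf_le1.
    have sV : 0 <= s^-1 by rewrite invr_ge0 ltW.
    apply/andP; split.
      by rewrite /dl !mulr_ge0// addr_ge0// mulr_ge0.
    rewrite /dl (_ : 4 * _ = 2 * (2 * L s) * (2 * (2^-1 * s^-1))); last first.
      by field; rewrite gt_eqF.
    apply: ler_pM.
    - by rewrite mulr_ge0.
    - by rewrite mulr_ge0 ?mulr_ge0// addr_ge0// mulr_ge0.
    - by rewrite ler_pM2l.
    - by rewrite ler_wpM2r ?mulr_ge0//; lra.
  + exact: cvg_cst.
  + rewrite -(mulr0 4); apply: cvgM; first exact: cvg_cst.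
    have -> : (fun s => L s / s) = (fun s => 2^-1 * (ln s / s) + k * s^-1).
      by apply/funext => s; rewrite /L mulrDl mulrA.
    rewrite -[X in _ --> X]addr0; apply: cvgD.
      rewrite -(mulr0 2^-1); apply: cvgM; first exact: cvg_cst.
      exact: cvg_ln_div_id.
    rewrite -(mulr0 k); apply: cvgM; first exact: cvg_cst.
    exact/cvgV_pinfty/cvg_id.
Unshelve. all: by end_near. Qed.

(** * From density asymptotics to tail probabilities *)

Lemma powR_expR_ln {R : realType} [x : R] (p : R) :
  0 < x -> x `^ p = expR (p * ln x).
Proof. by move=> x0; rewrite /powR gt_eqF. Qed.

Lemma cvg_powRN_pinfty {R : realType} [f : R -> R] [p : R] :
  0 < p -> f x @[x --> +oo] --> (+oo : set_system R) ->
  f x `^ (- p) @[x --> +oo] --> (0 : R).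
Proof.
move=> p0 fy; have pfy : p * ln (f x) @[x --> +oo] --> (+oo : set_system R).
  by apply: gt0_cvgMry => //; exact: cvg_comp fy cvg_ln_pinfty.
apply: cvg_trans (cvg_comp _ _ pfy (@cvgr_expR R)).
apply: near_eq_cvg; near=> x.
rewrite powR_expR_ln ?mulNr//; near: x; exact: cvgry_gt fy _.
Unshelve. all: by end_near. Qed.

(** Eventually [f / g = 1 + delta], and [|delta| <= k * |e|] squeezes [delta] to 0. *)
Lemma asymptotic_with_error_cvg {R : realType} [f g e : R -> R] :
  asymptotic_with_error f g e -> e x @[x --> +oo] --> (0 : R) ->
  (\forall x \near +oo, g x != 0) ->
  f x / g x @[x --> +oo] --> (1 : R).
Proof.
move=> [delta [/eqO_exP[k k0 dO] fE]] e0 g0.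
have d0 : delta x @[x --> +oo] --> (0 : R).
  apply: norm_cvg0.
  apply: (@squeeze_cvgr _ _ _ _ (fun=> 0) (fun x => k * `|e x|)).
  - near=> x; rewrite normr_ge0/=; near: x; exact: dO.
  - exact: cvg_cst.
  - rewrite -(mulr0 k); apply: cvgM; first exact: cvg_cst.
    by rewrite -(normr0 R); exact: cvg_norm.
have : 1 + delta x @[x --> +oo] --> (1 : R).
  by rewrite -[X in _ --> X]addr0; apply: cvgD => //; exact: cvg_cst.
apply: cvg_trans; apply: near_eq_cvg; near=> x.
have -> : f x = g x * (1 + delta x) by near: x.
by rewrite mulrC mulKf//; near: x.
Unshelve. all: by end_near. Qed.

(** Substituting [K^-1 * x] moves [ln x] by [- ln K]. The part [l] absorbs this in the limit, while
    the linear part contributes exactly [b * ln K], that is a factor [K^b]. *)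
Lemma rescaled_equiv {R : realType} [D l : R -> R] [b K : R] :
  0 < K -> vanishing_slope l ->
  D (K * x) / expR (l (ln x) - b * ln x) @[x --> +oo] --> (1 : R) ->
  D x / expR (l (ln x) + b * ln K - b * ln x) @[x --> +oo] --> (1 : R).
Proof.
move=> K0 lv DK.
have Ky : K^-1 * x @[x --> +oo] --> (+oo : set_system R).
  by apply: gt0_cvgMry; [rewrite invr_gt0|exact: cvg_id].
have DK' := cvg_comp _ _ Ky DK.
have shift : expR (l (ln x - ln K) - l (ln x)) @[x --> +oo] --> (1 : R).
  have diff0 :=
    cvg_comp _ _ (@cvg_ln_pinfty R) (vanishing_slope_shift (ln K) lv).
  by rewrite -(@expR0 R); exact: (cvg_comp _ _ diff0 (@continuous_expR R 0)).
rewrite -[X in _ --> X]mulr1; apply: cvg_trans (cvgM DK' shift).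
apply: near_eq_cvg; near=> x => /=.
have x0 : 0 < x by near: x; exact: (nbhs_pinfty_gt (num_real _)).
rewrite mulVKf ?gt_eqF// lnM ?posrE ?invr_gt0// lnV ?posrE// [- ln K + _]addrC.
rewrite -mulrA -!expRN -expRD; congr (_ * expR _); ring.
Unshelve. all: by end_near. Qed.

(** The complementary distribution function is the integral of the density over []y, +oo[].
    Agreement of [h] with the exponential form is asked only for large [y], where the logarithms are
    positive. *)
Lemma ccdf_equiv {R : realType} {d : measure_display}
    {Omega : measurableType d} {P : probability Omega R}
    [V : {RV P >-> R}] [D l h : R -> R] [a : R] :
  is_density V D -> 0 < a -> vanishing_slope l ->
  D x / expR (l (ln x) - (a + 1) * ln x) @[x --> +oo] --> (1 : R) ->
  (\forall y \near +oo, h y = a^-1 * expR (l (ln y) - a * ln y)) ->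
  asymptotic_equiv (fun y => fine (ccdf V y)) h.
Proof.
move=> [mD D0 DE] a0 lv Dl hE.
rewrite /asymptotic_equiv.
apply: cvg_trans (density_tail_equiv a0 lv mD D0 Dl).
apply: near_eq_cvg; near=> y; rewrite /ccdf DE//; congr (_ / _).
by apply/esym; near: y.
Unshelve. all: by end_near. Qed.

(** * The common form of the Stein-Stein and Heston densities *)

Lemma log_exp_factorE {R : realType} [b0 x : R] (p b2 : R) :
  0 < b0 -> 1 < x ->
  log_exp_factor b0 p b2 x =
  expR (ln b0 + p * ln (ln x) + b2 * Num.sqrt (ln x)).
Proof.
move=> b00 x1; rewrite /log_exp_factor powR_expR_ln ?ln_gt0//.
by rewrite !expRD lnK.
Qed.

Lemma vanishing_slope_log_exp {R : realType} (c p b2 : R) :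
  vanishing_slope (fun s => c + p * ln s + b2 * Num.sqrt s).
Proof.
apply: vanishing_slopeD; last exact: vanishing_slopeZ vanishing_slope_sqrt.
apply: vanishing_slopeD; first exact: vanishing_slope_cst.
exact: vanishing_slopeZ vanishing_slope_ln.
Qed.

(** Both models are instances, differing in the power [p] of the logarithm; [B * K^b] is the
    constant called [B0] or [A0]. *)
Lemma ccdf_log_exp {R : realType} {d : measure_display}
    {Omega : measurableType d} {P : probability Omega R}
    [V : {RV P >-> R}] [D : R -> R] [K B b p b2 : R] :
  is_density V D -> 0 < K -> 0 < B -> 1 < b ->
  asymptotic_with_error
    (fun x => D (K * x))
    (fun x => log_exp_factor B p b2 x * x `^ (- b))
    (fun x => ln x `^ (- 4^-1)) ->
  asymptotic_equiv
    (fun y => fine (ccdf V y))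
    (fun y => y `^ (- (b - 1)) *
              log_exp_factor ((b - 1)^-1 * (B * K `^ b)) p b2 y).
Proof.
move=> VD K0 B0 b1 asymp; have b10 : 0 < b - 1 by rewrite subr_gt0.
pose l s := ln B + p * ln s + b2 * Num.sqrt s.
have lv : vanishing_slope l by exact: vanishing_slope_log_exp.
have densE x : 1 < x ->
    log_exp_factor B p b2 x * x `^ (- b) = expR (l (ln x) - b * ln x).
  move=> x1; rewrite log_exp_factorE// powR_expR_ln ?(lt_trans ltr01)//.
  by rewrite -expRD mulNr.
have DK : D (K * x) / expR (l (ln x) - b * ln x) @[x --> +oo] --> (1 : R).
  have quot := asymptotic_with_error_cvg asymp.
  apply: cvg_trans (quot _ _).
  - apply: near_eq_cvg; near=> x.
    have x1 : 1 < x by near: x; exact: (nbhs_pinfty_gt (num_real _)).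
    by rewrite densE.
  - by apply: cvg_powRN_pinfty => //; exact: cvg_ln_pinfty.
  - near=> x.
    have x1 : 1 < x by near: x; exact: (nbhs_pinfty_gt (num_real _)).
    by rewrite densE// gt_eqF ?expR_gt0.
(* The constant [b * ln K] produced by undoing the rescaling is merged into [l], where it does not
   affect the slope. *)
have l'v : vanishing_slope (fun s => l s + b * ln K).
  by apply: vanishing_slopeD => //; exact: vanishing_slope_cst.
apply: (ccdf_equiv VD b10 l'v).
  by rewrite subrK; exact: rescaled_equiv.
near=> y.
have y1 : 1 < y by near: y; exact: (nbhs_pinfty_gt (num_real _)).
have y0 : 0 < y by exact: lt_trans y1.
have KbB : 0 < B * K `^ b by rewrite mulr_gt0 ?powR_gt0.
rewrite (powR_expR_ln _ y0).
rewrite log_exp_factorE ?mulr_gt0 ?invr_gt0 ?powR_gt0// -expRD.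
(* Writing [(b - 1)^-1] as an exponential too reduces the claim to an identity between exponents. *)
rewrite -[X in _ = X * _]lnK ?posrE ?invr_gt0// -expRD.
rewrite lnM ?posrE ?invr_gt0// lnM ?posrE ?powR_gt0// ln_powR /l.
by congr expR; ring.
Unshelve. all: by end_near. Qed.

(** * The Hull-White density *)

Lemma ccdf_hull_white {R : realType} {d : measure_display}
    {Omega : measurableType d} {P : probability Omega R}
    [V : {RV P >-> R}] [D : R -> R] [t y0 xi C0 c2 c3 : R] :
  is_density V D -> 0 < t -> 0 < y0 -> 0 < C0 ->
  asymptotic_with_error D
    (fun x => x ^- 2 * hull_white_factor t y0 xi C0 c2 c3 x)
    (fun x => ln (ln x) `^ (- 2^-1)) ->
  asymptotic_equiv
    (fun y => fine (ccdf V y))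
    (fun y => y^-1 * hull_white_factor t y0 xi C0 c2 c3 y).
Proof.
move=> VD t0 y00 C00 asymp.
(* With [s = ln x], the inner logarithm [ln (y0^-1 * sqrt (2 * s / t))] equals [2^-1 * ln s + k]. *)
pose k := ln (y0^-1 * Num.sqrt (2 / t)).
pose l s := ln C0 + (c2 - 1) / 2 * ln s + c3 * ln (ln s) +
  - (2 * t * xi ^+ 2)^-1 *
  (2^-1 * ln s + k + 2^-1 * ln (2^-1 * ln s + k)) ^+ 2.
have lv : vanishing_slope l.
  apply: vanishing_slopeD.
    apply: vanishing_slopeD; last exact: vanishing_slopeZ vanishing_slope_ln_ln.
    apply: vanishing_slopeD; first exact: vanishing_slope_cst.
    exact: vanishing_slopeZ vanishing_slope_ln.
  exact: vanishing_slopeZ (vanishing_slope_ln_sqr k).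
have lnln := cvg_comp _ _ (@cvg_ln_pinfty R) (@cvg_ln_pinfty R).
have facE : \forall x \near +oo,
    hull_white_factor t y0 xi C0 c2 c3 x = expR (l (ln x)).
  near=> x.
  have lx1 : 1 < ln x by near: x; exact: (cvgry_gt (@cvg_ln_pinfty R) _).
  have lx0 : 0 < ln x by exact: lt_trans lx1.
  have LE : ln (y0^-1 * Num.sqrt (2 * ln x / t)) = 2^-1 * ln (ln x) + k.
    have t20 : 0 < 2 / t by rewrite divr_gt0.
    rewrite /k mulrAC sqrtrM ?(ltW t20)// mulrA.
    rewrite lnM ?posrE ?mulr_gt0 ?invr_gt0 ?sqrtr_gt0// addrC; congr (_ + _).
    by rewrite -powR12_sqrt ?(ltW lx0)// ln_powR.
  rewrite /hull_white_factor LE powR_expR_ln// powR_expR_ln ?ln_gt0//.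
  by rewrite /l !expRD lnK.
have densE : \forall x \near +oo,
    x ^- 2 * hull_white_factor t y0 xi C0 c2 c3 x =
    expR (l (ln x) - (1 + 1) * ln x).
  near=> x.
  have x0 : 0 < x by near: x; exact: (nbhs_pinfty_gt (num_real _)).
  rewrite mulrC expRB (expRM_natl 2) lnK ?posrE//; congr (_ / _).
  by near: x.
(* Here [a = 1]: the density decays like [x^-2] up to its factor, so the tail has power -1 and
   [a^-1 = 1] leaves [C0] unchanged. *)
apply: (ccdf_equiv VD ltr01 lv).
- have quot := asymptotic_with_error_cvg asymp.
  apply: cvg_trans (quot _ _).
  + apply: near_eq_cvg; near=> x; congr (_ / _); near: x; exact: densE.
  + exact: cvg_powRN_pinfty lnln.
  + near=> x.
    have -> : x ^- 2 * hull_white_factor t y0 xi C0 c2 c3 x =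
      expR (l (ln x) - (1 + 1) * ln x) by near: x; exact: densE.
    by rewrite gt_eqF ?expR_gt0.
- near=> y.
  have y_gt0 : 0 < y by near: y; exact: (nbhs_pinfty_gt (num_real _)).
  rewrite invr1 !mul1r expRB lnK ?posrE// mulrC; congr (_ / _).
  by near: y.
Unshelve. all: by end_near. Qed.
Theorem theorem6p2 (R : realType) (d : measure_display)
    (Omega : measurableType d) (P : probability Omega R)
    (F : R -> set (set Omega)) (W Z X Y : R -> {RV P >-> R})
    (x0 y0 r t : R) (D : R -> R)
    (ht : 0 < t) (hD : is_density (X t) D) :
  [/\ (* Stein-Stein *)
      forall (q m sigma B1 B2 B3 : R),
        stein_stein_model F W Z X Y x0 y0 r q m sigma ->
        0 < B1 -> 0 < B2 -> 2 < B3 ->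
        asymptotic_with_error
          (fun x => D (x0 * expR (r * t) * x))
          (fun x => log_exp_factor B1 (- 2^-1) B2 x * x `^ (- B3))
          (fun x => ln x `^ (- 4^-1)) ->
        let B0 := B1 * (x0 * expR (r * t)) `^ B3 in
        asymptotic_equiv
          (fun y => fine (ccdf (X t) y))
          (fun y => y `^ (- (B3 - 1)) *
                    log_exp_factor ((B3 - 1)^-1 * B0) (- 2^-1) B2 y),
      (* Heston *)
      forall (q m c A1 A2 A3 : R),
        heston_model F W Z X Y x0 y0 r q m c ->
        0 < A1 -> 0 < A2 -> 2 < A3 ->
        asymptotic_with_error
          (fun x => D (x0 * expR (r * t) * x))
          (fun x => log_exp_factor A1 (- (3 / 4) + q * m / c ^+ 2) A2 x *
                    x `^ (- A3))
          (fun x => ln x `^ (- 4^-1)) ->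
        let A0 := A1 * (x0 * expR (r * t)) `^ A3 in
        asymptotic_equiv
          (fun y => fine (ccdf (X t) y))
          (fun y => y `^ (- (A3 - 1)) *
                    log_exp_factor ((A3 - 1)^-1 * A0)
                      (- (3 / 4) + q * m / c ^+ 2) A2 y)
    & (* Hull-White *)
      forall (nu xi C c2 c3 : R),
        hull_white_model F W Z X Y x0 y0 r nu xi ->
        0 < C ->
        let C0 := C * (x0 * expR (r * t)) ^+ 2 in
        asymptotic_with_error
          D
          (fun x => x ^- 2 * hull_white_factor t y0 xi C0 c2 c3 x)
          (fun x => ln (ln x) `^ (- 2^-1)) ->
        asymptotic_equiv
          (fun y => fine (ccdf (X t) y))
          (fun y => y^-1 * hull_white_factor t y0 xi C0 c2 c3 y) ].
Proof.
split.
- move=> q m sigma B1 B2 B3 [_ [x00 _ _ _ _] _ _] B10 _ B32 asymp B0.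
  (* The scale is [K = x0 * expR (r * t)], positive because the model has [x0 > 0]. *)
  apply: ccdf_log_exp asymp => //; first by rewrite mulr_gt0 ?expR_gt0.
  by apply: lt_trans B32; rewrite ltr1n.
- move=> q m c A1 A2 A3 [_ [x00 _ _ _ _] _ _] A10 _ A32 asymp A0.
  apply: ccdf_log_exp asymp => //; first by rewrite mulr_gt0 ?expR_gt0.
  by apply: lt_trans A32; rewrite ltr1n.
- move=> nu xi C c2 c3 [_ [x00 y00 _ _] _ _] C_gt0 C0 asymp.
  apply: ccdf_hull_white asymp => //.
  by rewrite mulr_gt0 ?exprn_gt0 ?mulr_gt0 ?expR_gt0.
Qed.
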